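(* Let $F$ be a minor-closed family of graphs which excludes a graph $M$ as a minor, where $M$ has $n$ vertices. Then there exists an infinite family of graphs $H_1,H_2,\dots$, each of treewidth at most $n+1$, such that for every $i$, any $\alpha$-approximation of the metric of $H_i$ by a distribution over dominating graph metrics of graphs in $F$ has $\alpha=\Omega(\log |H_i|)$, where the constant implicit in $\Omega$ may depend on $n$ (polynomially) but not on $i$.
   Context: Graphs carry their shortest-path metric (unit edge lengths). For a graph $H$ with metric $d_H$, an $\alpha$-approximation of $d_H$ by a distribution over dominating graph metrics in $F$ is a probability distribution over pairs $(U,\Phi_U)$, where $U\in F$ and $\Phi_U$ maps the vertices of $H$ to vertices of $U$, such that for all vertices $x,y$ of $H$: $d_U(\Phi_U(x),\Phi_U(y))\ge d_H(x,y)$ for every $U$ in the support (domination), and $\mathbb{E}[d_U(\Phi_U(x),\Phi_U(y))]\le \alpha\, d_H(x,y)$. $|H_i|$ denotes the size of $H_i$. *)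

(* Defs.v *)
From HB Require Import structures.
From mathcomp Require Import all_boot all_order all_algebra.
From mathcomp Require Import all_classical all_reals all_analysis.
Set Implicit Arguments. Unset Strict Implicit. Unset Printing Implicit Defensive.
Import Order.TTheory GRing.Theory Num.Theory.
Local Open Scope classical_set_scope.
Local Open Scope ring_scope.

Record sgraph := SGraph {
  vtx :> finType;
  adj : rel vtx;
  adj_sym : symmetric adj;
  adj_irr : irreflexive adj }.

(* Shortest-path metric with unit edge lengths, valued in extended reals:
   the infimum of lengths of adj-paths from x to y (+oo if none). *)
Definition gdist (R : realType) (G : sgraph) (x y : G) : \bar R :=
  ereal_inf [set ((size p)%:R)%:E | p in
               [set p : seq G | path (@adj G) x p && (last x p == y)]].

Definition connected_in (G : sgraph) (S : {set G}) : Prop :=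
  forall a b, a \in S -> b \in S ->
    connect [rel u v | [&& u \in S, v \in S & @adj G u v]] a b.

Definition gminor (M G : sgraph) : Prop :=
  exists f : M -> {set G},
    [/\ (forall u, f u != finset.set0),
        (forall u, connected_in (f u)),
        (forall u v, u != v -> f u :&: f v == finset.set0) &
        (forall u v, @adj M u v ->
           exists x y, [/\ x \in f u, y \in f v & @adj G x y])].

Definition minor_closed (F : sgraph -> Prop) : Prop :=
  forall G H : sgraph, gminor H G -> F G -> F H.

(* A tree: a nonempty connected graph with |V|-1 edges (each edge counted
   twice as an ordered pair). *)
Definition is_tree (T : sgraph) : Prop :=
  [/\ 0 < #|T|,
      (forall a b : T, connect (@adj T) a b) &
      #|finset.finset (fun p : T * T => @adj T p.1 p.2)| = (#|T| - 1).*2]%N.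

Definition treewidth_le (G : sgraph) (k : nat) : Prop :=
  exists (T : sgraph) (B : T -> {set G}),
    [/\ is_tree T,
        (forall x : G, exists t, x \in B t),
        (forall x y : G, @adj G x y -> exists t, (x \in B t) && (y \in B t)),
        (forall x : G, connected_in (finset.finset (fun t => x \in B t))) &
        (forall t, #|B t| <= k.+1)%N].

(* alpha-approximation of d_H by a (countably supported) distribution over
   dominating graph metrics of graphs in F: weights p k on pairs (U k, Phi k). *)
Definition dom_approx (R : realType) (F : sgraph -> Prop) (H : sgraph)
    (alpha : R) : Prop :=
  exists (p : nat -> R) (U : nat -> sgraph) (Phi : forall k, H -> U k),
    [/\ (forall k, 0 <= p k),
        (\sum_(0 <= k <oo) (p k)%:E = 1)%E,
        (forall k, 0 < p k ->
           F (U k) /\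
           forall x y : H, (gdist R x y <= gdist R (Phi k x) (Phi k y))%E) &
        (forall x y : H,
           (\sum_(0 <= k <oo) ((p k)%:E * gdist R (Phi k x) (Phi k y))
              <= alpha%:E * gdist R x y)%E)].

(* Main.v *)
(* Start from one edge and replace, again and again, every edge by a gadget: two
   terminals s, t joined through a bipartite graph that contains a K_n whose
   edges are subdivided, each bipartite edge lying on an s-t path of length 3.
   The subdivided K_n has width n - 1, so together with the terminals the
   treewidth stays at most n + 1 (for n >= 3; for n <= 2 no graph of the family
   has an edge, and a single edge is enough). Fix a dominating map into a graph U without
   the minor M and a scale s, and call an edge stretched if its image has length
   more than r = (3^s - 1) / 2. If, in a gadget whose edges have become copies of
   length 3^s, each copy had less than a 3^-s fraction of stretched edges, then
   every copy would contain an unstretched path between its ends (it contains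
   that many edge-disjoint paths). The r-neighbourhoods in U of the images
   of these paths are connected, and those of disjoint pieces of the gadget are
   disjoint, because such pieces are at distance 3^s > 2r and the map is
   dominating; this would give the minor M. Hence at each scale s a fraction of
   at least c 3^-s of all edges is stretched by more than 3^s / 2 - 1/2, and
   summing over the K scales the average stretch is at least of order K, while
   the logarithm of the size of the graph is also of order K. *)
Require Import Defs.
From HB Require Import structures.
From mathcomp Require Import all_boot all_order all_algebra.
From mathcomp Require Import all_classical all_reals all_analysis.
From mathcomp Require Import zify lra.
Set Implicit Arguments. Unset Strict Implicit. Unset Printing Implicit Defensive.
Import Order.TTheory GRing.Theory Num.Theory.
Local Open Scope ring_scope.

(** * Bounded distances and connected vertex sets *)

Lemma connect_closed (V : finType) (e : rel V) (P : V -> Prop) x y :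
  (forall a b, e a b -> P a -> P b) -> connect e x y -> P x -> P y.
Proof.
move=> h /connectP[p pP ->]; elim: p x pP => //= a p IH x /andP[xa ap] Px.
exact: IH (h _ _ xa Px).
Qed.

Section DistLe.
Variable G : sgraph.

Definition dist_le (n : nat) (x y : G) : Prop :=
  exists p : seq G, [/\ path (@adj G) x p, last x p = y & (size p <= n)%N].

Lemma dist_le_refl n x : dist_le n x x.
Proof. by exists [::]. Qed.

Lemma dist_le_trans m n x y z : dist_le m x y -> dist_le n y z -> dist_le (m + n)%N x z.
Proof.
move=> [p [pP py ps]] [q [qP qz qs]]; exists (p ++ q).
by rewrite cat_path last_cat pP py qP qz size_cat leq_add.
Qed.

Lemma dist_le_sym n x y : dist_le n x y -> dist_le n y x.
Proof.
move=> [p [pP py ps]]; exists (rev (belast x p)); split.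
- rewrite -py rev_path; apply: sub_path pP => a b; by rewrite adj_sym.
- by case: p {pP ps} py => [|a p] /= <- //; rewrite rev_cons last_rcons.
- by rewrite size_rev size_belast.
Qed.

Lemma restricted_connect_sym (S : {set G}) a b :
  connect [rel u v | [&& u \in S, v \in S & @adj G u v]] a b ->
  connect [rel u v | [&& u \in S, v \in S & @adj G u v]] b a.
Proof.
rewrite sym_connect_sym // => u v /=.
by rewrite adj_sym; case: (u \in S); case: (v \in S).
Qed.

Lemma connected_in_hub (S : {set G}) a0 :
  (forall a, a \in S ->
     connect [rel u v | [&& u \in S, v \in S & @adj G u v]] a0 a) ->
  connected_in S.
Proof.
move=> h a b aS bS; apply: connect_trans (h b bS).
exact: restricted_connect_sym (h a aS).
Qed.

End DistLe.

(** * Neighbourhoods of images, and minors built from overlapping connected sets *)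

Section Thick.
Variables (U : sgraph) (V : finType) (Phi : V -> U) (T : nat).

Definition thick (P : pred V) : {set U} :=
  finset.finset (fun z => `[< exists2 x, P x & dist_le T (Phi x) z >]).

Lemma thickP (P : pred V) z :
  z \in thick P <-> exists2 x, P x & dist_le T (Phi x) z.
Proof. by rewrite inE; split=> [/asboolP|?] //; apply/asboolP. Qed.

(** Every ball around a point [Phi x] is connected along prefixes of short paths. Consecutive points
    of a chain in [P] have images within [T], so each ball contains the centre of the next. *)
Lemma thick_connected (P : pred V) x0 :
  (forall x, P x ->
     connect [rel a b | [&& P a, P b & `[< dist_le T (Phi a) (Phi b) >]]] x0 x) ->
  connected_in (thick P).
Proof.
move=> h; apply: (@connected_in_hub _ _ (Phi x0)) => z.
set e := (X in connect X).
have ball x y : P x -> dist_le T (Phi x) y -> connect e (Phi x) y.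
  move=> Px [p [pP <- ps]] {y}; elim/last_ind: p pP ps => //= p y IH.
  rewrite rcons_path size_rcons last_rcons => /andP[pP ly] ps.
  apply: connect_trans (IH pP (ltnW ps)) _; apply: connect1 => /=.
  apply/and3P; split=> //; apply/thickP; exists x => //.
    by exists p; split=> //; exact: ltnW.
  by exists (rcons p y); rewrite rcons_path last_rcons size_rcons pP.
move=> /thickP[x Px xz]; apply: connect_trans (ball _ _ Px xz).
apply: (connect_closed (P := fun y => connect e (Phi x0) (Phi y))) (h x Px) _ => //.
move=> a b /= /and3P[Pa Pb /asboolP ab] /connect_trans; apply.
exact: ball.
Qed.

Lemma thick_disjoint (P Q : pred V) z :
  (forall x y, P x -> Q y -> ~ dist_le (T + T) (Phi x) (Phi y)) ->
  z \in thick P -> z \in thick Q -> False.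
Proof.
move=> h /thickP[x Px xz] /thickP[y Qy yz].
by apply: (h x y Px Qy); apply: dist_le_trans xz (dist_le_sym yz).
Qed.

End Thick.

(* The branch set of u is A u together with the part of each Q u v that can be
   reached from A u before Q u v enters A v. *)
Lemma minor_of_pieces (M U : sgraph) (A : M -> {set U}) (Q : M -> M -> {set U}) :
  (forall u, connected_in (A u)) ->
  (forall u v, connected_in (Q u v)) ->
  (forall u v, exists2 z, z \in A u & z \in Q u v) ->
  (forall u v, exists2 z, z \in A v & z \in Q u v) ->
  (forall u v z, u != v -> z \in A u -> z \in A v -> False) ->
  (forall u v w z, w != u -> w != v -> z \in Q u v -> z \in A w -> False) ->
  (forall u v u' v' z, u != u' -> z \in Q u v -> z \in Q u' v' -> False) ->
  gminor M U.
Proof.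
move=> Ac Qc AQ QA AA QAd QQ.
pose D u v : {set U} := finset.setD (Q u v) (A v).
pose e u v := [rel x y | [&& x \in D u v, y \in D u v & @adj U x y]].
pose R u v (z : U) := (z \in D u v) &&
  [exists a, [&& a \in A u, a \in Q u v & connect (e u v) a z]].
pose f u : {set U} := finset.finset
  (fun z => (z \in A u) || [exists v, (v != u) && R u v z]).
have AD u v a : u != v -> a \in A u -> a \in Q u v -> a \in D u v.
  move=> uv aA aQ; rewrite inE aQ andbT; apply/negP; exact: AA aA.
exists f; split.
- move=> u; have [z zA _] := AQ u u; apply/eqP => /setP/(_ z).
  by rewrite !inE zA.
- move=> u; have [a0 a0A _] := AQ u u.
  apply: (@connected_in_hub _ _ a0) => z; set e' := (X in connect X).
  have core a : a \in A u -> connect e' a0 a.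
    move=> /(Ac u _ _ a0A); apply: connect_sub => x y /= /and3P[xA yA xy].
    by apply: connect1; rewrite /e' /= !inE xA yA.
  rewrite inE => /orP[|/existsP[v /andP[vu]]]; first exact: core.
  rewrite /R => /andP[zD /existsP[a /and3P[aA aQ az]]].
  apply: connect_trans (core a aA) _.
  suff [] : connect e' a z /\ connect (e u v) a z by [].
  apply: (connect_closed (P := fun y => connect e' a y /\ connect (e u v) a y)) az _ => //.
  move=> x y exy [c1 c2]; have c3 := connect_trans c2 (connect1 exy); split=> //.
  have inf w : w \in D u v -> connect (e u v) a w -> w \in f u.
    move=> wD cw; rewrite inE; apply/orP; right; apply/existsP; exists v.
    rewrite vu /R wD /=; apply/existsP; exists a; by rewrite aA aQ.
  move: (exy) => /and3P[xD yD xy].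
  apply: connect_trans c1 (connect1 _).
  by rewrite /e' /= !inf.
- move=> u v uv; apply/eqP/setP => z; rewrite !inE; apply/negP.
  have half u' v' w : u' != v' -> w != u' -> R u' w z -> z \in A v' -> False.
    move=> uv' wu /andP[]; rewrite !inE => /andP[zA zQ] _ zv.
    (* If [A v'] is the set at which [Q u' w] stops, it was cut away in [D u' w]; any other [A v']
       is disjoint from the whole of [Q u' w]. *)
    have [vw|vw] := eqVneq v' w; first by rewrite -vw zv in zA.
    by apply: (QAd u' w v' z) => //; rewrite eq_sym.
  move=> /andP[/orP[zu|/existsP[w /andP[wu Rz]]] /orP[zv|/existsP[w' /andP[wv Rz']]]].
  + exact: AA uv zu zv.
  + by apply: half Rz' zu => //; rewrite eq_sym.
  + exact: half Rz zv.
  + move: Rz Rz' => /andP[zD _] /andP[zD' _]; move: zD zD'; rewrite !inE => /andP[_ zQ] /andP[_ zQ'].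
    exact: QQ uv zQ zQ'.
- move=> u v uv; have neq : u != v.
    by apply: contraTneq uv => ->; rewrite adj_irr.
  have [a aA aQ] := AQ u v; have [b bA bQ] := QA u v.
  (* Without an edge from [f u] to [f v], the reached part of [Q u v] never steps into [A v].
     Connectivity of [Q u v] would then carry it to [b], which [D u v] omits. *)
  apply: contrapT => H.
  have : R u v b.
    apply: (connect_closed (P := fun z => R u v z)) (Qc u v a b aQ bQ) _.
      move=> x y /and3P[xQ yQ xy] Rx; have [xD /existsP[a' /and3P[a'A a'Q a'x]]] := andP Rx.
      have yD : y \in D u v.
        rewrite inE yQ andbT; apply/negP => yA; apply: H; exists x, y; split=> //.
          rewrite inE; apply/orP; right; apply/existsP; exists v; by rewrite eq_sym neq.
        by rewrite inE yA.
      rewrite /R yD; apply/existsP; exists a'; rewrite a'A a'Q.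
      by apply: connect_trans a'x (connect1 _); apply/and3P.
    by rewrite /R AD //; apply/existsP; exists a; rewrite aA aQ connect0.
  by rewrite /R inE bA.
Qed.

(** * Multigraphs and the substitution of gadgets for edges *)

(** Edges form a type of their own because parallel edges must count separately: several paths of a
    gadget share the ends of their first edges, yet have to be edge-disjoint for the averaging. The
    orientation tells which end of an edge is which terminal. *)
Record mgraph := MGraph {
  mvtx : finType;
  medge : finType;
  msrc : medge -> mvtx;
  mtgt : medge -> mvtx }.

Section Undirected.
Variable X : mgraph.

Definition joined (P : pred (medge X)) : rel (mvtx X) := fun x y =>
  [exists e, P e && ((msrc e == x) && (mtgt e == y)
                     || (msrc e == y) && (mtgt e == x))].

Lemma joined_sym P : symmetric (joined P).
Proof. by move=> x y; apply: eq_existsb => e; rewrite orbC. Qed.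

Definition simple_adj : rel (mvtx X) := fun x y => (x != y) && joined predT x y.

Lemma simple_adj_sym : symmetric simple_adj.
Proof. by move=> x y; rewrite /simple_adj eq_sym joined_sym. Qed.

Lemma simple_adj_irr : irreflexive simple_adj.
Proof. by move=> x; rewrite /simple_adj eqxx. Qed.

Definition simple_of := SGraph simple_adj_sym simple_adj_irr.

Lemma lipschitz_path (R : realType) (g : mvtx X -> R) (x : simple_of) p :
  (forall e, `|g (msrc e) - g (mtgt e)| <= 1) ->
  path (@adj simple_of) x p -> `|g x - g (last x p)| <= (size p)%:R.
Proof.
move=> h; elim: p x => [|y p IH] x /=; first by rewrite subrr normr0.
move=> /andP[/andP[_ /existsP[e exy]] /IH {}IH].
have xy : `|g x - g y| <= 1.
  by move: exy => /= /orP[]/andP[/eqP<- /eqP<-] //; rewrite distrC.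
rewrite -nat1r; apply: le_trans (ler_distD (g y) _ _) _.
exact: lerD.
Qed.

End Undirected.

Section Gadget.
Variable M : finType.

(* The gadget has terminals s and t and a bipartite graph between the two
   middle layers, in which every pair (u, v) contributes the path
   c_u - a_uv - m_uv - b_uv - c_v: the first layer holds c_u and m_uv, the
   second a_uv = (u, v, true) and b_uv = (u, v, false). Each edge (b, _) of the
   gadget lies on the s-t path that passes through the bipartite edge b. *)
Definition bip_edge : finType := (M * M * bool * bool)%type.
Definition layer1 : finType := (M + M * M)%type.
Definition layer2 : finType := (M * M * bool)%type.
Definition gadget_edge : finType := (bip_edge * option bool)%type.

Definition port (r : layer2) : M := let: (u, v, a) := r in if a then u else v.

Definition lend (b : bip_edge) : layer1 :=
  let: (r, q) := b in if q then inr r.1 else inl (port r).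
Definition rend (b : bip_edge) : layer2 := b.1.

(** The tags [None], [Some true] and [Some false] are the first, middle and last edge of the path
    from [s] through the bipartite edge to [t]. *)
Definition gsrc (V : Type) (s t : V) (f : gadget_edge) : V + (layer1 + layer2) :=
  match f.2 with
  | None => inl s
  | Some true => inr (inl (lend f.1))
  | Some false => inr (inr (rend f.1))
  end.

Definition gtgt (V : Type) (s t : V) (f : gadget_edge) : V + (layer1 + layer2) :=
  match f.2 with
  | None => inr (inl (lend f.1))
  | Some true => inr (inr (rend f.1))
  | Some false => inl t
  end.

Variable X : mgraph.

Definition place (e : medge X) (z : mvtx X + (layer1 + layer2)) :
    mvtx X + medge X * (layer1 + layer2) :=
  match z with inl x => inl x | inr i => inr (e, i) end.

Definition step : mgraph :=
  @MGraph (mvtx X + medge X * (layer1 + layer2))%type (medge X * gadget_edge)%type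
    (fun ef => place ef.1 (gsrc (msrc ef.1) (mtgt ef.1) ef.2))
    (fun ef => place ef.1 (gtgt (msrc ef.1) (mtgt ef.1) ef.2)).

End Gadget.

(** * Iterated substitution: unspoiled walks and Lipschitz extensions *)

Section Iterate.
Variable M : finType.
Local Notation N := #|gadget_edge M|.

(** Substitution happens at the start graph, so an induction on [s] with [X] general meets the
    coarsest gadget first. *)
Fixpoint stepn (s : nat) (X : mgraph) : mgraph :=
  match s with 0%N => X | s'.+1 => stepn s' (step M X) end.

Fixpoint embed s X : mvtx X -> mvtx (stepn s X) :=
  match s return mvtx X -> mvtx (stepn s X) with
  | 0%N => id
  | s'.+1 => fun x => @embed s' (step M X) (inl x)
  end.

Fixpoint ancestor s X : medge (stepn s X) -> medge X :=
  match s return medge (stepn s X) -> medge X with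
  | 0%N => id
  | s'.+1 => fun e => (@ancestor s' (step M X) e).1
  end.

Lemma stepnD m s X : stepn (m + s) X = stepn s (stepn m X).
Proof. by elim: m X => //= m IH X. Qed.

Lemma card_medge_stepn s X : #|medge (stepn s X)| = (#|medge X| * N ^ s)%N.
Proof.
elim: s X => [|s IH] X /=; first by rewrite muln1.
by rewrite IH card_prod -mulnA expnS.
Qed.

Lemma card_gadget_edge : N = (3 * #|bip_edge M|)%N.
Proof. by rewrite card_prod card_option card_bool mulnC. Qed.

Lemma card_fibers (E F : finType) (P : pred E) (f : E -> F) :
  #|[pred e | P e]| = (\sum_(j : F) #|[pred e | P e && (f e == j)]|)%N.
Proof.
rewrite -sum1_card (partition_big f predT) //=; apply: eq_bigr => j _.
by rewrite -sum1_card; apply: eq_bigl => e; rewrite !inE.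
Qed.

(** Pigeonhole over the [N / 3] edge-disjoint paths of the coarsest gadget: one of them carries few
    enough bad edges that each of its three edges satisfies the bound for one level less, and the
    three walks concatenate. At level 0 the bound leaves no bad edge at all. *)
Lemma good_walk s X (bad : pred (medge (stepn s X))) (e : medge X) :
  (3 ^ s * #|[pred e' | bad e' && (ancestor e' == e)]| < N ^ s)%N ->
  connect (joined [pred e' | ~~ bad e' & ancestor e' == e])
    (embed s (msrc e)) (embed s (mtgt e)).
Proof.
elim: s X bad e => [|s IH] X bad e /=.
  rewrite !expn0 mul1n ltnS leqn0 => /eqP/card0_eq/(_ e).
  rewrite !inE eqxx andbT => bade; apply: connect1; apply/existsP; exists e.
  by rewrite /= bade !eqxx.
pose cnt (j : gadget_edge M) := #|[pred e' | bad e' && (@ancestor s (step M X) e' == (e, j))]|.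
have -> : #|[pred e' | bad e' && ((@ancestor s (step M X) e').1 == e)]| = (\sum_j cnt j)%N.
  rewrite (card_fibers _ (fun e' => (@ancestor s (step M X) e').2)).
  apply: eq_bigr => j _; apply: eq_card => e1; rewrite !inE -andbA; congr (_ && _).
move=> lt.
have [b hb] : exists b : bip_edge M, forall i, (3 ^ s * cnt (b, i) < N ^ s)%N.
  apply: contrapT => H; move: lt; apply/negP; rewrite -leqNgt.
  have {}H (b : bip_edge M) : (N ^ s <= 3 ^ s * \sum_i cnt (b, i))%N.
    apply: contrapT => /negP; rewrite -ltnNge => lt; apply: H; exists b => i.
    apply: leq_ltn_trans lt; rewrite leq_mul2l (bigD1 i) //= leq_addr.
    exact: orbT.
  rewrite expnS [X in (X * _)%N]card_gadget_edge -mulnA expnS -[X in (_ <= X)%N]mulnA leq_mul2l /=.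
  rewrite (eq_bigr (fun j => cnt (j.1, j.2))); last by case.
  rewrite -(pair_bigA _ (fun b i => cnt (b, i))) /= big_distrr /=.
  by rewrite -sum_nat_const; apply: leq_sum => b _; exact: H.
have sub (j : gadget_edge M) x y :
    connect (joined [pred e' | ~~ bad e' & @ancestor s (step M X) e' == (e, j)]) x y ->
    connect (joined [pred e' | ~~ bad e' & (@ancestor s (step M X) e').1 == e]) x y.
  apply: connect_sub => {}x {}y /existsP[e' /andP[/andP[ge ae] xy]].
  apply: connect1; apply/existsP; exists e'; rewrite xy /= ge (eqP ae) /=.
  by rewrite eqxx.
have h1 := sub _ _ _ (IH _ bad (e, (b, None)) (hb None)).
have h2 := sub _ _ _ (IH _ bad (e, (b, Some true)) (hb (Some true))).
have h3 := sub _ _ _ (IH _ bad (e, (b, Some false)) (hb (Some false))).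
exact: connect_trans h1 (connect_trans h2 h3).
Qed.

(* Linear interpolation along the s-t paths of the gadgets. *)
Lemma lipschitz_ext (R : realType) s X (g : mvtx X -> R) (c : R) :
  (forall e, `|g (msrc e) - g (mtgt e)| <= 3 ^+ s * c) ->
  exists g' : mvtx (stepn s X) -> R,
    [/\ forall x, g' (embed s x) = g x,
        forall e, `|g' (msrc e) - g' (mtgt e)| <= c &
        forall e a, g (msrc (ancestor e)) = a -> g (mtgt (ancestor e)) = a ->
          g' (msrc e) = a /\ g' (mtgt e) = a].
Proof.
elim: s X g => [|s IH] X g h.
  by exists g; split=> // e; have := h e; rewrite expr0 mul1r.
pose g1 (z : mvtx (step M X)) : R := match z with
  | inl x => g x
  | inr (e, inl _) => (2 * g (msrc e) + g (mtgt e)) / 3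
  | inr (e, inr _) => (g (msrc e) + 2 * g (mtgt e)) / 3
  end.
have [e|g' [g'E g'L g'C]] := IH (step M X) g1.
  case: e => e [b i]; have := h e; rewrite exprS -mulrA.
  set u := g _; set v := g _; set w := 3 ^+ s * c => le3.
  have {le3} : `|(u - v) / 3| <= w.
    by rewrite normrM [`|3^-1|]ger0_norm ?invr_ge0 // ler_pdivrMr // mulrC.
  move=> le3; apply: le_trans le3; rewrite le_eqVlt; apply/orP; left; apply/eqP.
  by congr `|_|; case: i => [[]|] /=; rewrite -/u -/v; lra.
exists g'; split=> [x||e a /= sa ta]; [exact: (g'E (inl x))|exact: g'L|].
by apply: g'C; case: (@ancestor s (step M X) e) sa ta => e1 [b i] /= sa ta;
  case: i => [[]|] //=; rewrite ?sa ?ta; lra.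
Qed.

End Iterate.

(** * Distances, scales and stretched edges *)

Section Distance.
Variables (R : realType) (G : sgraph).
Implicit Types x y : G.

Lemma dist_le_gdist n x y : dist_le n x y -> (gdist R x y <= n%:R%:E)%E.
Proof.
move=> [p [pP pl ps]]; apply: (@le_trans _ _ (size p)%:R%:E).
  by apply: ereal_inf_lbound; exists p => //=; rewrite pP pl eqxx.
by rewrite lee_fin ler_nat.
Qed.

Lemma gdist_ge (c : \bar R) x y :
  (forall p, path (@adj G) x p -> last x p = y -> (c <= (size p)%:R%:E)%E) ->
  (c <= gdist R x y)%E.
Proof.
move=> h; apply: le_ereal_inf_tmp => _ [p /= /andP[pP /eqP pl] <-]; exact: h.
Qed.

Lemma gdist_ge0 x y : (0 <= gdist R x y)%E.
Proof. by apply: gdist_ge => p _ _; rewrite lee_fin. Qed.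

End Distance.

Definition radius (s : nat) : nat := (3 ^ s)./2.

(** As [3 ^ s] is odd, two radii fall short of the distance [3 ^ s] between separate pieces by
    exactly one. *)
Lemma radius_double s : (3 ^ s = (radius s + radius s).+1)%N.
Proof. by rewrite addnn -{1}(odd_double_half (3 ^ s)) oddX orbT. Qed.

Definition stretched (U : sgraph) (X : mgraph) (Phi : mvtx X -> U) (s : nat)
    (e : medge X) : bool :=
  ~~ `[< dist_le (radius s) (Phi (msrc e)) (Phi (mtgt e)) >].

Section HeavyGadget.
Variables (R : realType) (M U : sgraph) (Y : mgraph) (s : nat) (e : medge Y).
Let H := stepn M s (step M Y).
Variable Phi : simple_of H -> U.
Hypothesis Phi_dom : forall x y : simple_of H,
  (gdist R x y <= gdist R (Phi x) (Phi y))%E.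
Hypothesis noM : ~ gminor M U.

Let center (b : bip_edge M) : mvtx H :=
  embed M s (inr (e, inl (lend b)) : mvtx (step M Y)).
Let fiber (b : bip_edge M) : pred (medge H) := [pred e' |
  ~~ stretched Phi s e' & @ancestor M s (step M Y) e' == (e, (b, Some true))].
(** The part of the copy of [b] reached from its first end along unstretched edges; whether it gets
    to the other end depends on how many edges are stretched. *)
Let piece (b : bip_edge M) : pred (mvtx H) := connect (joined (fiber b)) (center b).

(* Distances are bounded below by the 1-Lipschitz extension of 3^s times the
   indicator of K. *)
Lemma pieces_far (K : pred (layer1 M + layer2 M)) b b' x y :
  K (inl (lend b)) -> K (inr (rend b)) ->
  ~~ K (inl (lend b')) -> ~~ K (inr (rend b')) ->
  piece b x -> piece b' y -> ~ dist_le (radius s + radius s) (Phi x) (Phi y).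
Proof.
move=> Kb1 Kb2 Kb'1 Kb'2 bx b'y xy.
pose g (z : mvtx (step M Y)) : R :=
  if z is inr (e1, i) then (if (e1 == e) && K i then 3 ^+ s else 0) else 0.
have g01 z : g z = 0 \/ g z = 3 ^+ s.
  by case: z => [z|[e1 i]] /=; [left|case: ifP; [right|left]].
have [e1|g' [g'E g'L g'C]] := @lipschitz_ext M R s (step M Y) g 1.
  have h3 : 0 <= 3 ^+ s :> R by rewrite exprn_ge0.
  rewrite mulr1; case: (g01 (msrc e1)) => ->; case: (g01 (mtgt e1)) => ->;
    by rewrite ?subrr ?normr0 ?subr0 ?sub0r ?normrN ?ger0_norm.
(* When both ends of [b1] carry the same value, the extension is constant on the whole copy of
   [b1]. *)
have val b1 a z : g (inr (e, inl (lend b1))) = a -> g (inr (e, inr (rend b1))) = a ->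
    piece b1 z -> g' z = a.
  move=> ga ga' /(connect_closed (P := fun z => g' z = a)); apply; last first.
    by rewrite /center g'E.
  move=> z1 z2 /existsP[e' /andP[/andP[_ /eqP ae] zz]].
  have [|/=|v1 v2] := g'C e' a; rewrite ?ae //.
  by case/orP: zz => /andP[/eqP<- /eqP<-].
have vx : g' x = 3 ^+ s by apply: (val b) => //=; rewrite eqxx ?Kb1 ?Kb2.
have vy : g' y = 0 by apply: (val b') => //=; rewrite eqxx ?(negbTE Kb'1) ?(negbTE Kb'2).
have : ((3 ^+ s)%:E <= gdist R (x : simple_of H) y)%E.
  apply: gdist_ge => p pP pl; rewrite lee_fin.
  have := lipschitz_path g'L pP; rewrite pl vx vy subr0 ger0_norm //.
move=> /le_trans/(_ (Phi_dom x y))/le_trans/(_ (dist_le_gdist R xy)).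
by rewrite lee_fin -natrX ler_nat radius_double ltnn.
Qed.

(** Here [P] is a union of pieces with a common centre, and the unstretched edges inside a piece
    have ends whose images lie within the radius, as [thick_connected] demands. *)
Lemma hub_connected (P : pred (mvtx H)) c :
  (forall x, P x -> exists b, [/\ piece b x, c = center b & forall y, piece b y -> P y]) ->
  connected_in (thick Phi (radius s) P).
Proof.
move=> h; apply: (@thick_connected _ _ _ _ _ c) => x /h[b [bx -> bP]].
set r := (X in connect X).
suff [] : connect r (center b) x /\ piece b x by [].
apply: (connect_closed (P := fun x => connect r (center b) x /\ piece b x)) (bx) _.
  move=> y z yz [cy bY]; have bZ : piece b z := connect_trans bY (connect1 yz).
  split=> //; apply: connect_trans cy (connect1 _); rewrite /r /= !bP //=.
  apply/asboolP; case/existsP: yz => e' /andP[/andP[]].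
  rewrite /stretched negbK => /asboolP ge' _.
  by case/orP => /andP[/eqP<- /eqP<-] //; apply: dist_le_sym.
by split; exact: connect0.
Qed.

(** If every edge were light, [good_walk] would make each piece reach the second end of its copy.
    The star at c_u, as [A u], and the path a_uv - m_uv - b_uv, as [Q u v], then meet at a_uv, and
    [Q u v] meets [A v] at b_uv, so [minor_of_pieces] yields [M]. *)
Lemma heavy_gadget : exists j : gadget_edge M,
  (#|gadget_edge M| ^ s <=
   3 ^ s * #|[pred e' | stretched Phi s e' && (@ancestor M s (step M Y) e' == (e, j))]|)%N.
Proof.
apply: contrapT => light; apply: noM.
have tip (b : bip_edge M) : piece b (embed M s (inr (e, inr (rend b)) : mvtx (step M Y))).
  apply: (@good_walk M s (step M Y) (stretched Phi s) (e, (b, Some true))).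
  by rewrite ltnNge; apply/negP => le; apply: light; exists (b, Some true).
have hub b : piece b (center b) by exact: connect0.
pose A (u : M) : pred (mvtx H) := fun x =>
  [exists b : bip_edge M, [&& ~~ b.2, port b.1 == u & piece b x]].
pose Q (u v : M) : pred (mvtx H) := fun x => [exists a, piece (u, v, a, true) x].
have thickI (P : pred (mvtx H)) x : P x -> Phi x \in thick Phi (radius s) P.
  by move=> Px; apply/thickP; exists x => //; exact: dist_le_refl.
have AP u b x : ~~ b.2 -> port b.1 = u -> piece b x -> A u x.
  by move=> b2 bu bx; apply/existsP; exists b; rewrite b2 bu eqxx.
have QP u v a x : piece (u, v, a, true) x -> Q u v x.
  by move=> ax; apply/existsP; exists a.
apply: (@minor_of_pieces M U (fun u => thick Phi (radius s) (A u))
  (fun u v => thick Phi (radius s) (Q u v))).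
- move=> u; apply: (@hub_connected _ (center (u, u, true, false))).
  move=> x /existsP[[r q] /and3P[/= nq /eqP ru bx]].
  exists (r, q); split=> //; last by move=> y; exact: AP.
  by rewrite /center /= ru (negbTE nq).
- move=> u v; apply: (@hub_connected _ (center (u, v, true, true))).
  move=> x /existsP[a ax]; exists (u, v, a, true); split=> // y; exact: QP.
- move=> u v; exists (Phi (embed M s (inr (e, inr (u, v, true)) : mvtx (step M Y)))).
    exact: thickI (AP u (u, v, true, false) _ isT erefl (tip _)).
  exact: thickI (QP u v true _ (tip (u, v, true, true))).
- move=> u v; exists (Phi (embed M s (inr (e, inr (u, v, false)) : mvtx (step M Y)))).
    exact: thickI (AP v (u, v, false, false) _ isT erefl (tip _)).
  exact: thickI (QP u v false _ (tip (u, v, false, true))).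
- move=> u v z uv; apply: thick_disjoint => x y.
  move=> /existsP[[r q] /and3P[/= nq /eqP ru bx]] /existsP[[r' q'] /and3P[/= nq' /eqP ru' bx']].
  (* The star at c_u with its tips; other stars avoid it. *)
  pose K (i : layer1 M + layer2 M) := match i with
    | inl (inl w) => w == u | inl (inr _) => false | inr r => port r == u end.
  apply: (pieces_far (K := K)) bx bx' => /=;
    by rewrite ?(negbTE nq) ?(negbTE nq') /= ?ru ?ru' ?eqxx // eq_sym.
- move=> u v w z wu wv; apply: thick_disjoint => x y.
  move=> /existsP[a ax] /existsP[[[[u' v'] a'] q] /and3P[/= nq /eqP ruw bx]].
  (* The vertex m_uv with its two neighbours, which only the stars at c_u and c_v meet. *)
  pose K (i : layer1 M + layer2 M) := match i with
    | inl (inl _) => false | inl (inr p) => p == (u, v) | inr r => r.1 == (u, v) end.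
  apply: (pieces_far (K := K)) ax bx => //=; rewrite ?eqxx ?(negbTE nq) //.
  apply/negP => /eqP[eu ev]; move: ruw wu wv; rewrite eu ev.
  by case: (a') => ->; rewrite eqxx.
- move=> u v u' v' z uu'; apply: thick_disjoint => x y /existsP[a ax] /existsP[a' ax'].
  pose K (i : layer1 M + layer2 M) := match i with
    | inl (inl _) => false | inl (inr p) => p == (u, v) | inr r => r.1 == (u, v) end.
  apply: (pieces_far (K := K)) ax ax' => //=; rewrite ?eqxx //;
    by rewrite xpair_eqE eq_sym (negbTE uu').
Qed.

End HeavyGadget.

(** * Summing the stretch over all scales, and the lower bound on [alpha] *)

Section TotalStretch.
Variables (R : realType) (M U : sgraph).
Hypothesis noM : ~ gminor M U.
Local Notation N := #|gadget_edge M|.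

Definition dominating (X : mgraph) (Phi : mvtx X -> U) : Prop :=
  forall x y : simple_of X, (gdist R x y <= gdist R (Phi x) (Phi y))%E.

(** The last [s + 1] levels are gadgets with edges refined [s] times. In each gadget at least one of
    the [N] edges is heavy, which costs the factor [N]. *)
Lemma many_stretched s K X (Phi : mvtx (stepn M K X) -> U) :
  (s < K)%N -> dominating Phi ->
  (#|medge (stepn M K X)| <= N * (3 ^ s * #|[pred e | stretched Phi s e]|))%N.
Proof.
move=> sK; have KE : K = (K - s.+1 + s.+1)%N by rewrite subnK.
move: Phi; rewrite KE stepnD => {KE sK}; set Y := stepn M _ X => Phi dom.
rewrite card_medge_stepn.
rewrite expnS [X in (X <= _)%N]mulnCA leq_mul2l.
rewrite (card_fibers _ (fun e => (@ancestor M s (step M Y) e).1)) big_distrr /=.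
rewrite -sum_nat_const; apply/orP; right; apply: leq_sum => e _.
have [j /leq_trans] := heavy_gadget e dom noM; apply.
rewrite leq_mul2l; apply/orP; right; apply: subset_leq_card; apply/fintype.subsetP => e1.
by rewrite !inE => /andP[-> /eqP ->] /=.
Qed.

(** A geometric sum dominated by its largest term: if r < [q] is the top radius, it is at most r +
    (2 r + 1) <= 3 q. *)
Lemma sum_pow3_radius K q : (\sum_(s < K) 3 ^ s * (radius s < q) <= 3 * q)%N.
Proof.
elim: K => [|K IH]; first by rewrite big_ord0.
rewrite big_ord_recr /=; case: ltnP => [lt|_]; last by rewrite muln0 addn0.
have full : (\sum_(s < K) 3 ^ s * (radius s < q) <= radius K)%N.
  apply: (@leq_trans (\sum_(s < K) 3 ^ s)); first by apply: leq_sum => s _; lia.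
  suff /eqP : ((\sum_(s < K) 3 ^ s).*2.+1 == 3 ^ K)%N by rewrite radius_double; lia.
  elim: K {IH lt} => [|K /eqP IH]; first by rewrite big_ord0.
  by rewrite big_ord_recr expnS -IH /=; set a := (\sum_(_ < _) _)%N; apply/eqP; lia.
rewrite muln1 radius_double; move: full lt; set a := (\sum_(_ < _) _)%N; set r := radius K; clearbody a r => h1 h2.
lia.
Qed.

(** An image length is at least a third of the sum of [3 ^ s] over the scales stretching the edge.
    After exchanging sums, each of the [K] scales contributes at least a fraction [1 / N] of the
    number of edges. *)
Lemma stretch_sum K X (Phi : mvtx (stepn M K X) -> U) :
  (0 < N)%N -> dominating Phi ->
  ((K%:R * #|medge (stepn M K X)|%:R / (3 * N%:R))%:E
     <= \sum_e gdist R (Phi (msrc e)) (Phi (mtgt e)))%E.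
Proof.
move=> N0 dom; pose A e := (\sum_(s < K) 3 ^ s * stretched Phi s e)%N.
have AD e : (((A e)%:R / 3 : R)%:E <= gdist R (Phi (msrc e)) (Phi (mtgt e)))%E.
  apply: gdist_ge => p pP pl; rewrite lee_fin ler_pdivrMr // mulrC -natrM ler_nat.
  apply: leq_trans (sum_pow3_radius K (size p)); apply: leq_sum => s _.
  rewrite leq_mul2l; apply/orP; right; rewrite /stretched ltnNge.
  case: (boolP (size p <= radius s)%N) => [le|_]; last exact: leq_b1.
  by rewrite leqn0 eqb0 negbK; apply/asboolP; exists p.
apply: le_trans (lee_sum _ (fun e _ => AD e)); rewrite sumEFin lee_fin.
rewrite -mulr_suml -natr_sum invfM mulrCA [3^-1 * _]mulrC ler_pM2r ?invr_gt0 //.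
rewrite ler_pdivrMr ?ltr0n // -!natrM ler_nat exchange_big /= [X in (_ <= X)%N]mulnC big_distrr /=.
rewrite -[X in (X * _)%N]card_ord -sum_nat_const; apply: leq_sum => s _.
apply: leq_trans (many_stretched (ltn_ord s) dom) _.
rewrite leq_mul2l -big_distrr /=; apply/orP; right.
rewrite leq_mul2l -sum1_card big_mkcond; apply/orP; right.
by apply: leq_sum => e _; rewrite inE; case: ifP.
Qed.

End TotalStretch.

Lemma gdist_edge (R : realType) (X : mgraph) (e : medge X) :
  msrc e != mtgt e -> gdist R (msrc e : simple_of X) (mtgt e) = 1%E.
Proof.
move=> ne; apply/le_anti/andP; split.
  apply: (@dist_le_gdist R (simple_of X) 1); exists [:: mtgt e]; split=> //=; rewrite andbT.
  rewrite /simple_adj ne; apply/existsP; exists e; by rewrite /= !eqxx.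
apply: gdist_ge => -[_ /= /eqP|a p _ _]; first by rewrite (negbTE ne).
by rewrite lee_fin ler1n.
Qed.

Definition loopless (X : mgraph) := forall e : medge X, msrc e != mtgt e.

Lemma loopless_stepn (M : finType) s X : loopless X -> loopless (stepn M s X).
Proof. by elim: s X => //= s IH X _; apply: IH => -[e [b [[]|]]]; apply/eqP. Qed.

(** Averaging over edges: the expected image lengths add up to at most [alpha] times the number of
    edges, all edges having length 1, while each dominating map alone obeys [stretch_sum]. *)
Lemma dom_approx_stepn (R : realType) (M : sgraph) (F : sgraph -> Prop)
    (K : nat) (X : mgraph) (alpha : R) :
  (0 < #|M|)%N -> (0 < #|medge X|)%N -> loopless X ->
  (forall G, F G -> ~ gminor M G) ->
  dom_approx F (simple_of (stepn M K X)) alpha ->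
  K%:R / (3 * #|gadget_edge M|%:R) <= alpha.
Proof.
move=> M0 X0 lX noM [p [U [Phi [p0 p1 pF pA]]]].
have N0 : (0 < #|gadget_edge M|)%N.
  by rewrite !card_prod card_option card_bool !muln_gt0 M0.
set N := #|_| in N0 *; set H := stepn M K X in Phi pF pA *.
have E0 : (0 < #|medge H|)%N by rewrite card_medge_stepn muln_gt0 X0 expn_gt0 N0.
pose D k e := gdist R (Phi k (msrc e)) (Phi k (mtgt e)).
have pD0 e k : (0 <= (p k)%:E * D k e)%E by rewrite mule_ge0 ?gdist_ge0 ?lee_fin.
pose c : R := K%:R * #|medge H|%:R / (3 * N%:R).
suff : (c%:E <= \sum_(e : medge H) alpha%:E)%E.
  rewrite sumEFin lee_fin sumr_const -[alpha *+ _]mulr_natr /c mulrAC.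
  by rewrite ler_pM2r // ltr0n.
apply: (@le_trans _ _ (\sum_(e : medge H) \sum_(0 <= k <oo) ((p k)%:E * D k e))%E).
  rewrite -nneseries_sum; last by move=> e k _; exact: pD0.
  rewrite -[c%:E]mule1 -p1 -nneseriesZl; last by move=> k _; rewrite lee_fin.
  apply: lee_nneseries => k _.
    by rewrite mule_ge0 // lee_fin // /c divr_ge0 // mulr_ge0.
  rewrite -ge0_sume_distrr; last by move=> e _; exact: gdist_ge0.
  (* A pair of weight zero need not dominate, but its term is 0 even at infinite distance. *)
  rewrite muleC; have := p0 k; rewrite le_eqVlt => /orP[/eqP<-|pk].
    by rewrite !mul0e.
  have [FU dom] := pF _ pk.
  rewrite lee_wpmul2l ?lee_fin //.
  exact: (stretch_sum (noM _ FU) N0 dom).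
apply: lee_sum => e _; have := pA (msrc e) (mtgt e).
by rewrite gdist_edge ?mule1 //; exact: loopless_stepn.
Qed.

(** * Treewidth of the iterated graphs *)

(** A tree decomposition by parent pointers, with [dep] excluding cycles and [home x] the topmost
    bag of [x]. Connectivity becomes a local condition on a bag and its parent, so new bags can
    simply be hung below old ones. Here [w] bounds the bag size, one more than the width. *)
Definition rooted_decomposition (w : nat) (X : mgraph) : Prop :=
  exists (T : finType) (r : T) (par : T -> T) (dep : T -> nat)
    (B : T -> seq (mvtx X)) (home : mvtx X -> T) (node : medge X -> T),
    [/\ (forall t, t != r -> (dep (par t) < dep t)%N),
        (forall x, x \in B (home x)),
        (forall x t, x \in B t -> t != home x -> t != r /\ x \in B (par t)),
        (forall e, (msrc e \in B (node e)) && (mtgt e \in B (node e))) &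
        (forall t, (size (B t) <= w)%N)].

Section ParentTree.
Variables (T : finType) (r : T) (par : T -> T) (dep : T -> nat).
Hypothesis dep_par : forall t, t != r -> (dep (par t) < dep t)%N.

Definition child_of : rel T := fun a b => (a != r) && (par a == b).
Definition tree_adj : rel T := fun a b => child_of a b || child_of b a.

Lemma tree_adj_sym : symmetric tree_adj.
Proof. by move=> a b; rewrite /tree_adj orbC. Qed.

Lemma child_of_dep a b : child_of a b -> (dep b < dep a)%N.
Proof. by move=> /andP[ar /eqP <-]; exact: dep_par. Qed.

Lemma tree_adj_irr : irreflexive tree_adj.
Proof.
by move=> a; apply/negP; rewrite /tree_adj orbb => /child_of_dep; rewrite ltnn.
Qed.

Definition parent_tree := SGraph tree_adj_sym tree_adj_irr.

Lemma parent_tree_connect_root a : connect (@adj parent_tree) a r.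
Proof.
elim: (dep a).+1 {-2}a (ltnSn (dep a)) => // n IH {}a an.
have [->|ar] := eqVneq a r; first exact: connect0.
apply: connect_trans (IH (par a) _); last exact: leq_trans (dep_par ar) an.
by apply: connect1; rewrite /= /tree_adj /child_of ar eqxx.
Qed.

(** Each vertex other than the root gives its parent link once upwards and once downwards; depth
    keeps the two kinds of ordered pairs apart. *)
Lemma parent_tree_is_tree : is_tree parent_tree.
Proof.
split; first by apply/card_gt0P; exists r.
- move=> a b; apply: connect_trans (parent_tree_connect_root a) _.
  rewrite sym_connect_sym; last exact: tree_adj_sym.
  exact: parent_tree_connect_root.
pose up (a : T) := (a, par a); pose down (a : T) := (par a, a).
pose C : {set T} := finset.setD finset.setT (finset.set1 r).
have CE : #|C| = (#|T| - 1)%N by rewrite cardsDS ?finset.subsetT // cardsT cards1.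
have inC a : (a \in C) = (a != r) by rewrite !inE andbT.
transitivity #|finset.setU (finset.imset up (mem C)) (finset.imset down (mem C))|.
  apply: eq_card => -[a b]; rewrite !inE /= /tree_adj.
  apply/orP/orP => -[].
  - move=> /andP[ar /eqP <-]; left; apply/imsetP; exists a => //; by rewrite inC.
  - move=> /andP[br /eqP <-]; right; apply/imsetP; exists b => //; by rewrite inC.
  - by move=> /imsetP[c]; rewrite inC => cr [-> ->]; left; rewrite /child_of cr eqxx.
  - by move=> /imsetP[c]; rewrite inC => cr [-> ->]; right; rewrite /child_of cr eqxx.
rewrite cardsU disjoint_setI0; last first.
  apply/pred0P => -[a b] /=; apply/negP => /andP[/imsetP[c]]; rewrite inC => cr [-> ->].
  move=> /imsetP[d]; rewrite inC => dr [cE dE].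
  by have := dep_par cr; have := dep_par dr; rewrite dE -cE; lia.
rewrite cards0 subn0 !card_imset; first by rewrite CE addnn.
- by move=> a b [].
- by move=> a b [].
Qed.

End ParentTree.

Lemma rooted_decomposition_treewidth w X :
  rooted_decomposition w.+1 X -> treewidth_le (simple_of X) w.
Proof.
move=> [T [r [par [dep [B [home [node [dP hB hP nB sB]]]]]]]].
exists (parent_tree dP), (fun t => finset.finset (fun x => x \in B t)); split.
- exact: parent_tree_is_tree.
- by move=> x; exists (home x); rewrite inE.
- move=> x y /andP[_ /existsP[e xy]]; exists (node e); rewrite !inE.
  have /andP[eB eB'] := nB e.
  by case/orP: xy => /andP[/eqP <- /eqP <-]; rewrite eB eB'.
- move=> x; apply: (@connected_in_hub (parent_tree dP) _ (home x)) => t; rewrite !inE => xt.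
  apply: restricted_connect_sym; move: xt.
  elim: (dep t).+1 {-2}t (ltnSn (dep t)) => // n IH {}t tn xt.
  have [->|th] := eqVneq t (home x); first exact: connect0.
  have [tr xp] := hP _ _ xt th.
  apply: connect_trans (IH (par t) _ xp); last exact: leq_trans (dP _ tr) tn.
  by apply: connect1; rewrite /= !inE xt xp /= /tree_adj /child_of tr eqxx.
- by move=> t; apply: leq_trans (sB t); rewrite cardsE; exact: card_size.
Qed.

(** Below a bag holding the ends of [e] hangs a bag with both terminals and all c_u, of size
    [#|M| + 2]. Below that, each pair has a chain of three bags of size 5: the terminals with c_u,
    c_v, a_uv, then with c_v, a_uv, b_uv, then with a_uv, b_uv, m_uv. *)
Lemma rooted_decomposition_step (M : finType) w X :
  (5 <= w)%N -> (#|M| + 2 <= w)%N ->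
  rooted_decomposition w X -> rooted_decomposition w (step M X).
Proof.
move=> w5 wM [T [r [par [dep [B [home [node [dP hB hP nB sB]]]]]]]].
pose S := option (M * M * option bool)%type.
pose in1 (e : medge X) (i : layer1 M) : mvtx (step M X) := inr (e, inl i).
pose in2 (e : medge X) (i : layer2 M) : mvtx (step M X) := inr (e, inr i).
pose old (x : mvtx X) : mvtx (step M X) := inl x.
pose Tn : finType := (T + medge X * S)%type.
pose par' (t : Tn) : Tn := match t with
  | inl t => inl (par t)
  | inr (e, None) => inl (node e)
  | inr (e, Some (p, None)) => inr (e, None)
  | inr (e, Some (p, Some true)) => inr (e, Some (p, None))
  | inr (e, Some (p, Some false)) => inr (e, Some (p, Some true))
  end.
pose dep' (t : Tn) := match t with
  | inl t => dep t
  | inr (e, None) => (dep (node e)).+1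
  | inr (e, Some (p, None)) => (dep (node e)).+2
  | inr (e, Some (p, Some true)) => (dep (node e)).+3
  | inr (e, Some (p, Some false)) => (dep (node e)).+4
  end.
pose B' (t : Tn) : seq (mvtx (step M X)) := match t with
  | inl t => map old (B t)
  | inr (e, None) =>
      [:: old (msrc e), old (mtgt e) & [seq in1 e (inl u) | u <- enum M]]
  | inr (e, Some (p, None)) =>
      [:: old (msrc e); old (mtgt e); in1 e (inl p.1); in1 e (inl p.2); in2 e (p, true)]
  | inr (e, Some (p, Some true)) =>
      [:: old (msrc e); old (mtgt e); in1 e (inl p.2); in2 e (p, true); in2 e (p, false)]
  | inr (e, Some (p, Some false)) =>
      [:: old (msrc e); old (mtgt e); in2 e (p, true); in2 e (p, false); in1 e (inr p)]
  end.
pose home' (x : mvtx (step M X)) : Tn := match x with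
  | inl x => inl (home x)
  | inr (e, inl (inl u)) => inr (e, None)
  | inr (e, inl (inr p)) => inr (e, Some (p, Some false))
  | inr (e, inr (p, a)) => inr (e, Some (p, if a then None else Some true))
  end.
pose node' (f : medge (step M X)) : Tn :=
  let: (e, ((p, a, q), i)) := f in
  if q && (i != Some false) then inr (e, Some (p, Some false))
  else if ~~ q && (i == None) then inr (e, None)
  else inr (e, Some (p, if a then None else Some true)).
have enumE e u : in1 e (inl u) \in [seq in1 e (inl u) | u <- enum M].
  by apply/mapP; exists u; rewrite ?mem_enum.
exists Tn, (inl r : Tn), par', dep', B', home', node'; split.
- by case=> [t|[e [[p [[]|]]|]]] //= tr; exact: dP.
- case=> [x|[e [[u|p]|[p []]]]] /=; rewrite ?inE ?eqxx ?orbT //.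
  by apply/mapP; exists x => //; exact: hB.
  by apply/or3P; apply: Or33; exact: enumE.
- move=> x [t|[e [[p a]|]]].
  + move=> /mapP[y yt ->] th; have [|tr yp] := hP _ _ yt; first by apply: contraNneq th => ->.
    by split=> //; exact: map_f.
  + by case: a => [[]|]; rewrite !inE => /or4P[/eqP->|/eqP->|/eqP->|/orP[]/eqP->];
      rewrite /home' ?eqxx // => _; split=> //; rewrite /par' /B' ?inE ?eqxx ?enumE ?orbT.
  + have /andP[sB' tB'] := nB e.
    rewrite 2!inE => /or3P[/eqP->|/eqP->|/mapP[u _ ->]] /=; last by rewrite eqxx.
      by move=> _; split=> //; exact: map_f.
    by move=> _; split=> //; exact: map_f.
- move=> [e [[[[u v] a] q] i]]; rewrite /node'.
  by case: q; case: a; case: i => [[]|] /=; rewrite ?inE ?eqxx ?orbT ?enumE.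
- case=> [t|[e [[p [[]|]]|]]] //=; first by rewrite size_map.
  by rewrite size_map -cardE -addn2.
Qed.

(** For [i = 0] this starts the iteration; the isolated vertices make the sizes unbounded when [M]
    has at most two vertices. *)
Definition edge_and_isolated (i : nat) : mgraph :=
  @MGraph (bool + 'I_i)%type unit (fun=> inl true) (fun=> inl false).

Lemma rooted_decomposition_edge w i :
  (2 <= w)%N -> rooted_decomposition w (edge_and_isolated i).
Proof.
move=> w2; exists (option 'I_i), None, (fun=> None), (fun t => isSome t : nat),
  (fun t => if t is Some k then [:: inr k] else [:: inl true; inl false]),
  (fun x => match x with inl _ => None | inr k => Some k end), (fun=> None).
split=> //.
- by case.
- by case=> [[]|k]; rewrite inE ?eqxx ?orbT.
- move=> x [k|]; rewrite !inE; first by move=> /eqP->; rewrite eqxx.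
  by case/orP=> /eqP->.
- by case=> [k|] //=; exact: ltnW.
Qed.

Lemma rooted_decomposition_stepn (M : finType) w s X :
  (5 <= w)%N -> (#|M| + 2 <= w)%N ->
  rooted_decomposition w X -> rooted_decomposition w (stepn M s X).
Proof.
move=> w5 wM; elim: s X => //= s IH X hX.
exact/IH/rooted_decomposition_step.
Qed.

(** * Sizes of the iterated graphs *)

Section Sizes.
Variable M : finType.
Lemma card_gadget_edgeE : #|gadget_edge M| = (12 * #|M| ^ 2)%N.
Proof. by rewrite card_gadget_edge !card_prod card_bool; nia. Qed.

Hypothesis M0 : (0 < #|M|)%N.

Lemma card_mvtx_step X :
  #|mvtx (step M X)| = (#|mvtx X| + #|medge X| * (#|M| + 3 * #|M| ^ 2))%N.
Proof.
by rewrite card_sum card_prod !card_sum !card_prod card_bool; congr addn; nia.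
Qed.

(** The summand [#|medge X|] on the left closes the induction: a step adds at most [N - 1] vertices
    per edge. *)
Lemma card_mvtx_stepn_le s X :
  (#|mvtx (stepn M s X)| + #|medge X|
     <= #|mvtx X| + #|medge X| * #|gadget_edge M| ^ s)%N.
Proof.
elim: s X => [|s IH] X; first by rewrite muln1.
have := IH (step M X); rewrite card_mvtx_step [stepn _ _.+1 _]/=.
have -> : #|medge (step M X)| = (#|medge X| * #|gadget_edge M|)%N by exact: card_prod.
rewrite [(_ ^ s.+1)%N]expnS [(_ * (_ * _ ^ s))%N]mulnA.
have le : (#|M| + 3 * #|M| ^ 2 + 1 <= #|gadget_edge M|)%N by rewrite card_gadget_edgeE; nia.
have := leq_mul (leqnn #|medge X|) le; rewrite mulnDr muln1.
by lia.
Qed.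

Lemma card_mvtx_stepn_ge s X :
  (0 < #|medge X|)%N -> (s + #|mvtx X| <= #|mvtx (stepn M s X)|)%N.
Proof.
elim: s X => //= s IH X X0; apply: leq_trans (IH (step M X) _).
  rewrite card_mvtx_step addSn -addnS leq_add2l -addn1 leq_add2l muln_gt0 X0.
  by rewrite addn_gt0 M0.
have -> : #|medge (step M X)| = (#|medge X| * #|gadget_edge M|)%N by exact: card_prod.
by rewrite muln_gt0 X0 card_gadget_edgeE; nia.
Qed.

End Sizes.

(** * Excluded graphs with at most two vertices *)

Lemma gminor_of_edge (M U : sgraph) (a b : U) :
  (#|M| <= 2)%N -> adj a b -> gminor M U.
Proof.
move=> M2 ab; pose c (u : M) := if (enum_rank u : nat) == 0%N then a else b.
have nab : a != b by apply: contraTneq ab => ->; rewrite adj_irr.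
have r2 (u : M) : (enum_rank u < 2)%N := leq_trans (ltn_ord _) M2.
have cE (u v : M) : u != v -> (c u = a /\ c v = b) \/ (c u = b /\ c v = a).
  move=> uv; have : (enum_rank u : nat) != enum_rank v.
    by apply: contraNneq uv => /ord_inj/enum_rank_inj ->.
  move: (r2 u) (r2 v); rewrite /c.
  case: (enum_rank u) (enum_rank v) => [[|[|x]] ?] [[|[|y]] ?] //=; by [left|right].
exists (fun u => finset.set1 (c u)); split.
- by move=> u; apply/eqP => /setP/(_ (c u)); rewrite !inE eqxx.
- by move=> u x y; rewrite !inE => /eqP-> /eqP->; exact: connect0.
- move=> u v /cE cuv; apply/eqP/setP => x; rewrite !inE.
  apply/negP => /andP[/eqP-> /eqP]; case: cuv => -[-> ->] /eqP.
    by rewrite (negbTE nab).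
  by rewrite eq_sym (negbTE nab).
- move=> u v uv; exists (c u), (c v); rewrite !inE !eqxx; split=> //.
  have /cE : u != v by apply: contraTneq uv => ->; rewrite adj_irr.
  by case=> -[-> ->] //; rewrite adj_sym.
Qed.

(** Graphs of the family have no edge, and domination keeps the ends of [e] apart, so their images
    are at infinite distance with positive probability. *)
Lemma no_dom_approx_small (R : realType) (M : sgraph) (F : sgraph -> Prop)
    (X : mgraph) (e : medge X) (alpha : R) :
  (#|M| <= 2)%N -> loopless X -> (forall G, F G -> ~ gminor M G) ->
  ~ dom_approx F (simple_of X) alpha.
Proof.
move=> M2 lX noM [p [U [Phi [p0 p1 pF pA]]]].
have [k pk] : exists k, 0 < p k.
  apply: contrapT => H; have pz k : p k = 0.
    by apply/le_anti; rewrite p0 andbT leNgt; apply/negP => pk; apply: H; exists k.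
  move: p1; rewrite eseries0 => [/eqP|k _ _]; last by rewrite pz.
  by rewrite eqe eq_sym oner_eq0.
have [FU dom] := pF k pk.
pose D k := gdist R (Phi k (msrc e)) (Phi k (mtgt e)).
have D1 : (1 <= D k)%E by have := dom (msrc e) (mtgt e); rewrite gdist_edge.
have Dinfty : D k = +oo%E.
  apply/eqP; rewrite -leye_eq; apply: gdist_ge => -[|b q] /= pP pl.
    have := D1; rewrite /D pl; have /(_ R) := dist_le_gdist _ (dist_le_refl 0 (Phi k (mtgt e))).
    by move=> h1 /le_trans/(_ h1); rewrite lee_fin ler10.
  by move: pP => /andP[/(gminor_of_edge M2)/(noM _ FU)].
have := pA (msrc e) (mtgt e); rewrite gdist_edge //.
rewrite (nneseries_pinfty (k := k)) // ?mule1 //.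
- by move=> j _; rewrite mule_ge0 ?gdist_ge0 ?lee_fin.
- by rewrite [gdist _ _ _]Dinfty gt0_muley // lte_fin.
Qed.

(** * Choice of the family and of the constants *)

Theorem theorem1 (R : realType) :
  exists (C : R) (e : nat), 0 < C /\
  forall (M : sgraph) (F : sgraph -> Prop),
    minor_closed F ->
    (forall G, F G -> ~ gminor M G) ->
    exists H : nat -> sgraph,
      [/\ (forall i, treewidth_le (H i) #|M|.+1),
          (forall i, i <= #|H i|)%N &
          (forall i (alpha : R), dom_approx F (H i) alpha ->
             ln (#|H i|%:R) / (C * (#|M|.+1)%:R ^+ e) <= alpha)].
Proof.
(* From ln V <= 2 K N and alpha >= K / (3 N) the denominator must be at least 6 N^2, where N = 12
   [#|M|]^2; this is 864 [#|M|]^4. *)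
exists 864, 4%N; split=> [|M F _ noM]; first by rewrite ltr0n.
(* The gadget bags of size 5 need [#|M|.+2 >= 5]. *)
have [M2|M3] := leqP #|M| 2.
  exists (fun i => simple_of (edge_and_isolated i)); split=> [i|i|i alpha].
  - exact/rooted_decomposition_treewidth/rooted_decomposition_edge.
  - by rewrite card_sum card_ord leq_addl.
  - by move=> /(@no_dom_approx_small _ _ _ (edge_and_isolated i) tt _ M2 _ noM)[].
have M0 : (0 < #|M|)%N by apply: leq_trans M3.
(* At least one step is taken: the bound V <= (2 N)^K fails for the bare edge. *)
exists (fun i => simple_of (stepn M i.+1 (edge_and_isolated 0))).
have card0 : #|mvtx (edge_and_isolated 0)| = 2%N.
  by rewrite card_sum card_bool card_ord.
have card1 : #|medge (edge_and_isolated 0)| = 1%N by rewrite card_unit.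
split=> [i|i|i alpha].
- apply/rooted_decomposition_treewidth/rooted_decomposition_stepn; [lia|lia|].
  exact: rooted_decomposition_edge.
- have /= := @card_mvtx_stepn_ge _ M0 i.+1 (edge_and_isolated 0).
  by rewrite card0 card1 => /(_ isT); apply: leq_trans; lia.
move=> /(dom_approx_stepn M0) -/(_ _ _ noM) h.
have {h} h : i.+1%:R / (3 * #|gadget_edge M|%:R) <= alpha :> R by apply: h; rewrite ?card1.
apply: le_trans h; set N := #|gadget_edge M|; set K := i.+1.
set V := #|_|.
have N0 : (0 < N)%N by rewrite /N card_gadget_edgeE; nia.
have VN : (V <= (2 * N) ^ K)%N.
  have := @card_mvtx_stepn_le _ M0 K (edge_and_isolated 0).
  rewrite card0 card1 -/V -/N expnMn => le.
  have h1 : (0 < N ^ K)%N by rewrite expn_gt0 N0.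
  have h2 : (2 <= 2 ^ K)%N by rewrite /K expnS leq_pmulr // expn_gt0.
  by have := leq_mul h2 (leqnn (N ^ K)); lia.
have V0 : (0 < V)%N by apply/card_gt0P; exists (embed M K (inl true : mvtx (edge_and_isolated 0))).
have lnV : ln (V%:R : R) <= K%:R * (2 * N%:R).
  apply: (@le_trans _ _ (ln ((2 * N%:R) ^+ K))).
    by rewrite ler_ln ?posrE ?exprn_gt0 ?mulr_gt0 ?ltr0n // -natrM -natrX ler_nat.
  rewrite lnXn ?mulr_gt0 ?ltr0n // -[X in X <= _]mulr_natl ler_wpM2l ?ler0n //.
  by apply/ltW/ln_sublinear; rewrite mulr_gt0 ?ltr0n.
rewrite ler_pdivrMr; last by rewrite mulr_gt0 ?exprn_gt0 ?ltr0n.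
apply: le_trans lnV _.
rewrite [leRHS]mulrAC ler_pdivlMr; last by rewrite mulr_gt0 ?ltr0n.
rewrite -[leLHS]mulrA ler_wpM2l ?ler0n //.
rewrite -natrX -!natrM ler_nat /N card_gadget_edgeE.
have : (#|M| ^ 4 <= #|M|.+1 ^ 4)%N by rewrite leq_exp2r.
by move: (#|M|.+1 ^ 4)%N; nia.
Qed.
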